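(* Let $\hat M = M(\hat{\bm x})$ be the plug-in maximum likelihood estimator and $L$ the average Kullback-Leibler loss in the multi-relational network model described in the context. Let the number of entities $N \to \infty$ and let $C, K, U, d_E, d_R, \alpha, \gamma$ be fixed constants (not depending on $N$). Assume that the true parameter satisfies $\bm x^* \in \Theta = \mathcal{E}^N \times \mathcal{R}^K$, where $\mathcal{E}$ and $\mathcal{R}$ are Euclidean balls of radius $U$, and that $\phi$ is Lipschitz: $|\phi(\bm u) - \phi(\bm v)| \le \alpha \|\bm u - \bm v\|$ for all $\bm u, \bm v \in \mathcal{E}^2 \times \mathcal{R}$. Then: (i) When $t > 0$ is a fixed constant, $$\log P\big(L(\hat M, M^* ) \geq t\big) \lesssim - \frac{t}{5C}\, n.$$ (ii) When $t = 10C \frac{m}{n} \log \frac{n}{m}$, $$\log P\big(L(\hat M, M^* ) \geq t\big) \lesssim - m \log \frac{n}{m}.$$ (iii) Furthermore, $$E\big[L(\hat M, M^* )\big] \lesssim 10C\, \frac{m}{n} \log \frac{n}{m}.$$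
   Context: Notation: $[N]=\{1,\dots,N\}$; $\sigma(x) = e^x/(1+e^x)$; $D(p\|q) = p\log\frac{p}{q} + (1-p)\log\frac{1-p}{1-q}$ is the Kullback-Leibler divergence between Bernoulli$(p)$ and Bernoulli$(q)$; $\|\cdot\|$ is the Euclidean norm. For positive sequences, $a \lesssim b$ means $\limsup_{N\to\infty} a/b \le 1$; for negative sequences, $a \lesssim b$ means $\liminf_{N\to\infty} a/b \ge 1$. Model: There are $N$ entities and $K$ relations; $\Lambda = [N]\times[N]\times[K]$ is the set of edges. $\mathcal{E}\subset\mathbb{R}^{d_E}$ and $\mathcal{R}\subset\mathbb{R}^{d_R}$ are compact sets, $\Theta = \mathcal{E}^N\times\mathcal{R}^K$, and elements of $\Theta$ are written $\bm x = (\bm\theta_1,\dots,\bm\theta_N,\bm w_1,\dots,\bm w_K)$. For $\lambda=(i,j,k)\in\Lambda$ put $\bm x_\lambda = (\bm\theta_i,\bm\theta_j,\bm w_k)$. Given a score function $\phi:\mathcal{E}^2\times\mathcal{R}\to\mathbb{R}$, let $M_\lambda(\bm x) = \sigma(\phi(\bm x_\lambda))$ and $M(\bm x) = (M_\lambda(\bm x))_{\lambda\in\Lambda}$. The true parameter is $\bm x^*$, $M^* = M(\bm x^* )$, and the $Y_\lambda$, $\lambda\in\Lambda$, are independent Bernoulli$(M^*_\lambda)$ variables. Each edge is observed independently with probability $\gamma\in(0,1]$, independently of $Y$; $\mathcal{S}\subset\Lambda$ is the random set of observed edges. Put $n = \gamma N^2 K$ (expected number of observed edges), $m = N d_E + K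 d_R$ (dimension of $\Theta$), and $C = \sup_{\bm u\in\mathcal{E}^2\times\mathcal{R}}|\phi(\bm u)|$; it is assumed throughout that $C\ge 2$. Estimator: the log-likelihood is $l(\bm x;Y_{\mathcal{S}}) = \sum_{\lambda\in\mathcal{S}} \big[Y_\lambda\log M_\lambda(\bm x) + (1-Y_\lambda)\log(1-M_\lambda(\bm x))\big]$; $\hat{\bm x}$ is a maximizer of $l(\bm x;Y_{\mathcal{S}})$ over $\bm x\in\Theta$ (not necessarily unique), and $\hat M = M(\hat{\bm x})$. Loss: $L(\hat M,M^* ) = \frac{1}{|\Lambda|}\sum_{\lambda\in\Lambda} D(M^*_\lambda\|\hat M_\lambda)$. *)

(* Defs.v *)
From HB Require Import structures.
From mathcomp Require Import all_boot all_order all_algebra.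
From mathcomp Require Import all_classical all_reals all_analysis.

Set Implicit Arguments.
Unset Strict Implicit.
Unset Printing Implicit Defensive.

Import Order.TTheory GRing.Theory Num.Theory.
Import numFieldNormedType.Exports.

Local Open Scope classical_set_scope.
Local Open Scope ring_scope.

(* The library's norm on 'rV[R]_d is the sup norm, hence this definition. *)
Definition enorm (R : realType) (d : nat) (v : 'rV[R]_d) : R :=
  Num.sqrt (\sum_(i < d) v 0 i ^+ 2).

Definition eball (R : realType) (d : nat) (c : 'rV[R]_d) (r : R) :
    set 'rV[R]_d :=
  [set v | enorm (v - c) <= r].

Definition sigmoid (R : realType) (x : R) : R := expR x / (1 + expR x).

Definition KL_bernoulli (R : realType) (p q : R) : R :=
  p * ln (p / q) + (1 - p) * ln ((1 - p) / (1 - q)).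

(* The ratios live in \bar R because a may be the logarithm of a probability
   that vanishes, i.e. -oo. *)
Definition lesssim_pos (R : realType) (a b : nat -> \bar R) : Prop :=
  (limn_esup (fun N => a N / b N) <= 1)%E.

Definition lesssim_neg (R : realType) (a b : nat -> \bar R) : Prop :=
  (1 <= limn_einf (fun N => a N / b N))%E.

Definition mutually_independent (d d' : measure_display)
    (T : measurableType d) (T' : measurableType d') (R : realType)
    (P : probability T R) (I : finType) (X : I -> {RV P >-> T'}) : Prop :=
  forall (J : {set I}) (A : I -> set T'),
    (forall i, measurable (A i)) ->
    P (\bigcap_(i in [set` J]) (X i @^-1` A i)) =
      (\prod_(i in J) P (X i @^-1` A i))%E.

Definition edge (N K : nat) : finType := ('I_N * 'I_N * 'I_K)%type.

Definition param (R : realType) (dE dR N K : nat) : Type :=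
  (('I_N -> 'rV[R]_dE) * ('I_K -> 'rV[R]_dR))%type.

Definition Theta (R : realType) (dE dR : nat)
    (E : set 'rV[R]_dE) (Rel : set 'rV[R]_dR) (N K : nat) :
    set (param R dE dR N K) :=
  [set x | (forall i, E (x.1 i)) /\ (forall k, Rel (x.2 k))].
Arguments Theta {R dE dR} E Rel N K.

(* E^2 x Rel as a subset of R^(dE + dE + dR). *)
Definition score_domain (R : realType) (dE dR : nat)
    (E : set 'rV[R]_dE) (Rel : set 'rV[R]_dR) : set 'rV[R]_(dE + dE + dR) :=
  [set u | [/\ E (lsubmx (lsubmx u)), E (rsubmx (lsubmx u)) & Rel (rsubmx u)]].

Definition at_edge (R : realType) (dE dR N K : nat)
    (x : param R dE dR N K) (l : edge N K) : 'rV[R]_(dE + dE + dR) :=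
  row_mx (row_mx (x.1 l.1.1) (x.1 l.1.2)) (x.2 l.2).

Definition Mprob (R : realType) (dE dR N K : nat)
    (phi : 'rV[R]_(dE + dE + dR) -> R) (x : param R dE dR N K)
    (l : edge N K) : R :=
  sigmoid (phi (at_edge x l)).

Definition loglik (R : realType) (dE dR N K : nat)
    (phi : 'rV[R]_(dE + dE + dR) -> R) (y : edge N K -> bool)
    (S : {set edge N K}) (x : param R dE dR N K) : R :=
  \sum_(l in S) ((y l)%:R * ln (Mprob phi x l)
                 + (1 - (y l)%:R) * ln (1 - Mprob phi x l)).

Definition is_mle (R : realType) (dE dR N K : nat)
    (phi : 'rV[R]_(dE + dE + dR) -> R) (Th : set (param R dE dR N K))
    (y : edge N K -> bool) (S : {set edge N K}) (x : param R dE dR N K) :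
    Prop :=
  Th x /\ forall x', Th x' -> loglik phi y S x' <= loglik phi y S x.

Definition observed (N K : nat) (T : Type) (O : edge N K -> T -> bool)
    (w : T) : {set edge N K} :=
  [set l | O l w]%SET.

(* Y l is the label of the edge l and O l indicates that l is observed;
   independence is that of the joint family of the Y l and the O l. *)
Definition network_model (d : measure_display) (T : measurableType d)
    (R : realType) (P : probability T R) (N K : nat)
    (Y O : edge N K -> {RV P >-> bool}) (M : edge N K -> R) (gamma : R) :
    Prop :=
  [/\ forall l, distribution P (Y l) =1 bernoulli_prob (M l),
      forall l, distribution P (O l) =1 bernoulli_prob gamma
    & mutually_independent
        (fun i : edge N K + edge N K =>
           match i with inl l => Y l | inr l => O l end)].

Definition avg_loss (R : realType) (N K : nat) (Mhat M : edge N K -> R) : R :=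
  (\sum_l KL_bernoulli (M l) (Mhat l)) / #|edge N K|%:R.

Definition nobs (R : realType) (gamma : R) (N K : nat) : R :=
  gamma * N%:R ^+ 2 * K%:R.

Definition pdim (R : realType) (dE dR N K : nat) : R :=
  (N * dE + K * dR)%:R.

(* Main.v *)
(* A union bound over a grid.  Cutting each coordinate of the parameter space
   into k cells of width of order 1/k gives about k^m classes of parameters, and
   within a class the log-likelihood varies by at most O(n/k), uniformly in the
   data.  Hence, if the estimator has loss at least t, some class contains a
   representative x of loss at least t whose log-likelihood is at least that of
   the true parameter minus O(n/k).  By the Chernoff bound with exponent 1/2
   this has probability at most exp(O(n/k) - gamma * sum_l H_l), with
   H_l = 1 - sqrt(p q) - sqrt((1 - p)(1 - q)) the Hellinger deficit between
   p = M^*_l and q = M_l(x).  As all log-ratios are bounded by C, one has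
   D(p||q) <= 4 C H_l, whence
     P(L >= t) <= (k+1)^m exp(O(n/k) - n t / (4 C)).
   The gap between 4C and 5C (resp. 10C) absorbs the other factors, with k
   constant in (i) and k of order n/m in (ii). *)

Require Import Defs.
From mathcomp Require Import all_boot all_order all_algebra.
From mathcomp Require Import all_classical all_reals all_analysis.
From mathcomp Require Import measurable_realfun ring lra.

Set Implicit Arguments.
Unset Strict Implicit.
Unset Printing Implicit Defensive.

Import Order.TTheory GRing.Theory Num.Theory.
Import numFieldNormedType.Exports.

Local Open Scope classical_set_scope.
Local Open Scope ring_scope.

(** * Bernoulli divergence against Hellinger deficit *)

Lemma ln_le_subr1 (R : realType) (x : R) : 0 < x -> ln x <= x - 1.
Proof.
move=> x0; rewrite -{1}(addrNK 1 x) addrC.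
by apply: le_ln1Dx; lra.
Qed.

(* With s = (p / q)^(1/4) and l = ln s this is kl_term_le divided by q.  The
   fourth root makes the bound ln s <= s - 1 sharp enough. *)
Lemma hellinger_poly (R : realType) (C s l : R) :
  2 <= C -> 0 < s -> l <= s - 1 -> 4 * l <= C ->
  4 * s ^+ 4 * l + 1 - s ^+ 4 <= 2 * C * (s ^+ 2 - 1) ^+ 2.
Proof.
move=> C2 s0 ls lC.
have s40 : 0 < s ^+ 4 by rewrite exprn_gt0.
have sq0 : 0 <= (s ^+ 2 - 1) ^+ 2 by rewrite sqr_ge0.
(* With l replaced by s - 1, both sides vanish to second order at s = 1, so (s - 1)^2 splits off.
   The cubic that remains is positive up to s = 3/2. *)
have [s32|s32] := lerP s (3 / 2).
  have h1 : 4 * s ^+ 4 * l <= 4 * s ^+ 4 * (s - 1) by nra.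
  have h2 : 4 * (s ^+ 2 - 1) ^+ 2 <= 2 * C * (s ^+ 2 - 1) ^+ 2 by nra.
  suff h3 : 4 * s ^+ 4 * (s - 1) + 1 - s ^+ 4 <= 4 * (s ^+ 2 - 1) ^+ 2 by lra.
  rewrite -subr_ge0.
  have -> : 4 * (s ^+ 2 - 1) ^+ 2 - (4 * s ^+ 4 * (s - 1) + 1 - s ^+ 4)
    = (s - 1) ^+ 2 * (3 + 6 * s + s ^+ 2 - 4 * s ^+ 3) by ring.
  apply: mulr_ge0; first exact: sqr_ge0.
  have : s ^+ 2 <= (3 / 2) ^+ 2 by rewrite lerXn2r// nnegrE; lra.
  rewrite !exprS expr0; nra.
have s2 : 9 / 4 < s ^+ 2 by rewrite expr2; nra.
have s4E : s ^+ 4 = s ^+ 2 * s ^+ 2 by rewrite -exprD.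
(* Of the lower bounds 2 and 4 l for C, the first is the better one when l <= 1/2. *)
have [l12|l12] := lerP l (1 / 2).
  have h1 : 4 * s ^+ 4 * l <= 2 * s ^+ 4 by nra.
  have h2 : 4 * (s ^+ 2 - 1) ^+ 2 <= 2 * C * (s ^+ 2 - 1) ^+ 2 by nra.
  suff h3 : s ^+ 4 + 1 <= 4 * (s ^+ 2 - 1) ^+ 2 by lra.
  rewrite s4E; move: (s ^+ 2) s2 => y; rewrite expr2; nra.
have h2 : 8 * l * (s ^+ 2 - 1) ^+ 2 <= 2 * C * (s ^+ 2 - 1) ^+ 2 by nra.
suff h3 : 4 * s ^+ 4 * l + 1 - s ^+ 4 <= 8 * l * (s ^+ 2 - 1) ^+ 2 by lra.
(* The goal is linear in l: it reads l (16 s^2 - 8 - 4 s^4) <= s^4 - 1. A nonnegative coefficient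
   allows l <= s - 1 to be used; a negative one gives the two sides opposite signs. *)
have [hp|hp] := lerP 0 (16 * s ^+ 2 - 8 - 4 * s ^+ 4).
  have h4 : l * (16 * s ^+ 2 - 8 - 4 * s ^+ 4)
            <= (s - 1) * (16 * s ^+ 2 - 8 - 4 * s ^+ 4) by nra.
  suff h5 : (s - 1) * (16 * s ^+ 2 - 8 - 4 * s ^+ 4) <= s ^+ 4 - 1.
    by move: h4 h5; rewrite s4E; move: (s ^+ 2) => y; rewrite expr2; nra.
  have -> : s ^+ 4 - 1 = (s - 1) * ((s + 1) * (s ^+ 2 + 1)) by ring.
  apply: ler_wpM2l; first lra.
  rewrite s4E; move: s2 s32; rewrite expr2; nra.
have : l * (16 * s ^+ 2 - 8 - 4 * s ^+ 4) <= 0 by nra.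
have : 1 <= s ^+ 4 by rewrite s4E; nra.
rewrite s4E; move: (s ^+ 2) => y; rewrite expr2; nra.
Qed.

(** The correction q - p makes a single term of the divergence comparable with the square of sqrt p
    - sqrt q. The corrections for (p, q) and (1 - p, 1 - q) cancel in the sum. *)
Lemma kl_term_le (R : realType) (C p q : R) :
  2 <= C -> 0 < p -> 0 < q -> ln (p / q) <= C ->
  p * ln (p / q) + q - p <= 2 * C * (p + q - 2 * Num.sqrt (p * q)).
Proof.
move=> C2 p0 q0 hC.
pose s := Num.sqrt (Num.sqrt (p / q)).
have pq0 : 0 < p / q by rewrite divr_gt0.
have s0 : 0 < s by rewrite !sqrtr_gt0.
have s2 : s ^+ 2 = Num.sqrt (p / q) by rewrite sqr_sqrtr// sqrtr_ge0.
have s4 : s ^+ 4 = p / q by rewrite (exprM s 2 2) s2 sqr_sqrtr// ltW.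
have lE : ln (p / q) = 4 * ln s by rewrite -s4 lnXn// mulr_natl.
have pE : p = q * s ^+ 4 by rewrite s4 mulrC divfK// gt_eqF.
have sqE : Num.sqrt (p * q) = q * s ^+ 2.
  have qs0 : 0 <= q * s ^+ 2 by rewrite mulr_ge0 ?sqr_ge0// ltW.
  by rewrite -(ger0_norm qs0) -sqrtr_sqr {1}pE; congr Num.sqrt; ring.
have := hellinger_poly C2 s0 (ln_le_subr1 s0) (ltac:(by rewrite -lE)).
move=> /(ler_wpM2l (ltW q0)).
rewrite sqE lE pE.
by congr (_ <= _); ring.
Qed.

Lemma kl_le_hellinger (R : realType) (C p q : R) :
  2 <= C -> 0 < p < 1 -> 0 < q < 1 ->
  ln (p / q) <= C -> ln ((1 - p) / (1 - q)) <= C ->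
  KL_bernoulli p q <=
    4 * C * (1 - (Num.sqrt (p * q) + Num.sqrt ((1 - p) * (1 - q)))).
Proof.
move=> C2 /andP[p0 p1] /andP[q0 q1] h1 h2.
have p1' : 0 < 1 - p by rewrite subr_gt0.
have q1' : 0 < 1 - q by rewrite subr_gt0.
have := kl_term_le C2 p0 q0 h1; have := kl_term_le C2 p1' q1' h2.
by rewrite /KL_bernoulli; lra.
Qed.

Lemma kl_ge0 (R : realType) (p q : R) :
  0 < p < 1 -> 0 < q < 1 -> 0 <= KL_bernoulli p q.
Proof.
have gibbs (a b : R) : 0 < a -> 0 < b -> a - b <= a * ln (a / b).
  move=> a0 b0; have ba : 0 < b / a by rewrite divr_gt0.
  have := ler_wpM2l (ltW a0) (ln_le_subr1 ba).
  rewrite -[in ln _](invf_div a b) lnV ?posrE ?divr_gt0//.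
  by rewrite mulrBr mulr1 mulrCA divff ?gt_eqF// mulr1; lra.
move=> /andP[p0 p1] /andP[q0 q1].
have := gibbs p q p0 q0; have := gibbs (1 - p) (1 - q).
rewrite !subr_gt0 => /(_ p1 q1); rewrite /KL_bernoulli; lra.
Qed.

Lemma kl_le (R : realType) (C p q : R) :
  0 < p < 1 -> ln (p / q) <= C -> ln ((1 - p) / (1 - q)) <= C ->
  KL_bernoulli p q <= C.
Proof. by move=> /andP[p0 p1] h1 h2; rewrite /KL_bernoulli; nra. Qed.

(** * Log-ratios of sigmoids *)

Lemma sigmoid_gt0_lt1 (R : realType) (a : R) : 0 < sigmoid a < 1.
Proof.
have e0 := expR_gt0 a.
by rewrite /sigmoid divr_gt0 ?addr_gt0//= ltr_pdivrMr ?mul1r ?ltrDr ?addr_gt0.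
Qed.

Lemma sigmoidN (R : realType) (a : R) : 1 - sigmoid a = sigmoid (- a).
Proof.
rewrite /sigmoid expRN; have e0 := expR_gt0 a; field.
by rewrite !gt_eqF// ?addr_gt0.
Qed.

Lemma ln_sigmoid_lip (R : realType) (a b : R) :
  ln (sigmoid a) - ln (sigmoid b) <= `|a - b|.
Proof.
have /andP[sa _] := sigmoid_gt0_lt1 a; have /andP[sb _] := sigmoid_gt0_lt1 b.
have ea := expR_gt0 a; have eb := expR_gt0 b.
have ez := expR_gt0 `|a - b|.
rewrite -ln_div ?posrE// -[leRHS]expRK ler_ln ?posrE ?divr_gt0//.
rewrite ler_pdivrMr// /sigmoid mulrA ler_pdivrMr ?addr_gt0//.
rewrite mulrAC ler_pdivlMr ?addr_gt0//.
have h1 : expR a <= expR `|a - b| * expR b.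
  by rewrite -expRD ler_expR; have := ler_norm (a - b); lra.
have h2 : 1 <= expR `|a - b| by rewrite -expR0 ler_expR.
have h3 := ler_peMl (mulr_ge0 (ltW ea) (ltW eb)) h2.
by nra.
Qed.

(** [ln_sigmoid_lip] would only give 2C. Clearing denominators leaves e^a + e^a e^b <= e^C e^b + e^C
    e^a e^b, whose terms are matched crosswise: e^a with e^C e^a e^b, and e^a e^b with e^C e^b. *)
Lemma ln_sigmoid_ratio_le (R : realType) (C a b : R) :
  `|a| <= C -> `|b| <= C -> ln (sigmoid a / sigmoid b) <= C.
Proof.
rewrite !ler_norml => /andP[a1 a2] /andP[b1 b2].
have /andP[sa _] := sigmoid_gt0_lt1 a; have /andP[sb _] := sigmoid_gt0_lt1 b.
have ea := expR_gt0 a; have eb := expR_gt0 b; have eC := expR_gt0 C.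
rewrite -[leRHS]expRK ler_ln ?posrE ?divr_gt0// ler_pdivrMr//.
rewrite /sigmoid mulrA ler_pdivrMr ?addr_gt0//.
rewrite mulrAC ler_pdivlMr ?addr_gt0//.
have h1 : expR a <= expR C by rewrite ler_expR.
have h2 : 1 <= expR C * expR b by rewrite -expRD -expR0 ler_expR; lra.
by nra.
Qed.

(** * The finite law of labels and observation flags *)

Definition bern (R : realType) (p : R) (b : bool) : R :=
  if b then p else 1 - p.

(* The two booleans of an outcome are the label and the observation flag. *)
Definition outcome (N K : nat) : finType := {ffun edge N K -> bool * bool}.

Definition outcome_weight (R : realType) (N K : nat) (M : edge N K -> R)
    (gamma : R) (f : outcome N K) : R :=
  \prod_l (bern (M l) (f l).1 * bern gamma (f l).2).

Definition llr (R : realType) (N K : nat) (M M' : edge N K -> R)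
    (f : outcome N K) : R :=
  \sum_l (if (f l).2 then ln (bern (M' l) (f l).1) - ln (bern (M l) (f l).1)
          else 0).

Definition outcome_event (N K : nat) (T : Type) (Y O : edge N K -> T -> bool)
    (f : outcome N K) : set T :=
  [set w | forall l, Y l w = (f l).1 /\ O l w = (f l).2].

Lemma outcome_weight_ge0 (R : realType) (N K : nat) (M : edge N K -> R)
    (gamma : R) (f : outcome N K) :
  (forall l, 0 <= M l <= 1) -> 0 <= gamma <= 1 ->
  0 <= outcome_weight M gamma f.
Proof.
have bern_ge0 (p : R) b : 0 <= p <= 1 -> 0 <= bern p b.
  by move=> /andP[p0 p1]; rewrite /bern; case: b; rewrite ?subr_ge0.
by move=> M01 g01; apply: prodr_ge0 => l _; rewrite mulr_ge0 ?bern_ge0.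
Qed.

Lemma bernoulli_prob1 (R : realType) (p : R) (b : bool) :
  0 <= p <= 1 -> bernoulli_prob p [set b] = (bern p b)%:E.
Proof. by move=> p01; rewrite /bernoulli_prob p01 fsbig_set1; case: b. Qed.

Section model.
Variables (d : measure_display) (T : measurableType d) (R : realType).
Variables (P : probability T R) (N K : nat).
Variables (Y O : edge N K -> {RV P >-> bool}) (M : edge N K -> R) (gamma : R).
Hypotheses (M01 : forall l, 0 <= M l <= 1) (gamma01 : 0 <= gamma <= 1).
Hypothesis YO : network_model Y O M gamma.

Let X (i : edge N K + edge N K) : {RV P >-> bool} :=
  match i with inl l => Y l | inr l => O l end.

Let v (f : outcome N K) (i : edge N K + edge N K) : bool :=
  match i with inl l => (f l).1 | inr l => (f l).2 end.

Let outcome_eventE (f : outcome N K) : outcome_event Y O f =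
  \bigcap_(i in [set` [set: edge N K + edge N K]%SET]) (X i @^-1` [set v f i]).
Proof.
apply/seteqP; split=> w /= h.
  by move=> [] l _ /=; have [] := h l.
by move=> l; split; [apply: (h (inl l))|apply: (h (inr l))]; rewrite /= inE.
Qed.

Lemma measurable_outcome_event f : measurable (outcome_event Y O f).
Proof.
rewrite outcome_eventE; apply: fin_bigcap_measurable => // i _.
rewrite -[X in measurable X]setTI; exact: measurable_funP.
Qed.

Lemma prob_outcome_event f :
  P (outcome_event Y O f) = (outcome_weight M gamma f)%:E.
Proof.
case: YO => dY dO ind.
rewrite outcome_eventE (ind _ (fun i => [set v f i])) // big_sumType /=.
rewrite /outcome_weight big_split /= EFinM -!prodEFin; congr (_ * _)%E.
  under eq_bigl do rewrite inE; apply: eq_bigr => l _.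
  by rewrite -bernoulli_prob1// -dY.
under eq_bigl do rewrite inE; apply: eq_bigr => l _.
by rewrite -bernoulli_prob1// -(dO l).
Qed.

(** The finitely many outcome events with [G f] cover [A], so subadditivity reduces the probability
    to a finite sum. Only an inclusion is asked because the estimator may depend on [w] beyond the
    observed data. *)
Lemma prob_le_outcome_weight (A : set T) (G : pred (outcome N K)) :
  measurable A ->
  (forall w, A w -> G [ffun l => (Y l w, O l w)]) ->
  (P A <= (\sum_(f | G f) outcome_weight M gamma f)%:E)%E.
Proof.
move=> mA AG.
pose B f := if G f then outcome_event Y O f else set0.
pose D := [set` index_enum (outcome N K)].
have AB : A `<=` \bigcup_(f in D) B f.
  move=> w Aw; exists [ffun l => (Y l w, O l w)].
    by rewrite /D /= mem_index_enum.
  by rewrite /B AG// => l; rewrite ffunE.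
have mB f : D f -> measurable (B f).
  by rewrite /B; case: ifP => // _ _; exact: measurable_outcome_event.
apply: (le_trans (content_sub_fsum P _ mB mA AB)); first exact: finite_seq.
rewrite /D -fsbig_seq ?index_enum_uniq// -sumEFin [leRHS]big_mkcond /=.
apply: lee_sum => f _; rewrite /B; case: ifP => _; last by rewrite measure0.
by rewrite prob_outcome_event.
Qed.
End model.

(** * Chernoff bound with exponent 1/2 *)

Lemma bern_sqrt (R : realType) (p q : R) (b : bool) :
  0 < p < 1 -> 0 < q < 1 ->
  bern p b * expR ((ln (bern q b) - ln (bern p b)) / 2)
    = Num.sqrt (bern p b * bern q b).
Proof.
move=> /andP[p0 p1] /andP[q0 q1].
have : 0 < bern p b by rewrite /bern; case: b; rewrite ?subr_gt0.
have : 0 < bern q b by rewrite /bern; case: b; rewrite ?subr_gt0.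
move: (bern p b) (bern q b) => a c c0 a0.
have E : a * expR ((ln c - ln a) / 2) =
         Num.sqrt ((a * expR ((ln c - ln a) / 2)) ^+ 2).
  by rewrite sqrtr_sqr ger0_norm// mulr_ge0 ?expR_ge0// ltW.
rewrite E; congr Num.sqrt; rewrite exprMn -expRM_natl.
rewrite mulr_natl -mulr_natr divfK ?pnatr_eq0// expRD expRN !lnK ?posrE//.
by field; rewrite gt_eqF.
Qed.

(** Weight and exponential both factor over the edges, so the sum over outcomes becomes a product of
    sums over four cases. An unobserved edge contributes 1 - gamma, an observed one gamma times the
    Hellinger affinity. *)
Lemma sum_outcome_chernoff (R : realType) (N K : nat) (M M' : edge N K -> R)
    (gamma : R) :
  (forall l, 0 < M l < 1) -> (forall l, 0 < M' l < 1) ->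
  \sum_(f : outcome N K) outcome_weight M gamma f * expR (llr M M' f / 2) =
  \prod_l (1 - gamma * (1 - (Num.sqrt (M l * M' l) +
                             Num.sqrt ((1 - M l) * (1 - M' l))))).
Proof.
move=> M01 M'01.
pose F l (b : bool * bool) := bern (M l) b.1 * bern gamma b.2 *
  expR ((if b.2 then ln (bern (M' l) b.1) - ln (bern (M l) b.1) else 0) / 2).
transitivity (\sum_(f : outcome N K) \prod_l F l (f l)).
  apply: eq_bigr => f _; rewrite /llr mulr_suml expR_sum.
  by rewrite /outcome_weight -big_split.
rewrite -bigA_distr_bigA; apply: eq_bigr => l _.
rewrite -(pair_bigA _ (fun a b => F l (a, b))) /= !big_bool /F /=.
rewrite mul0r expR0 !mulr1.
have := bern_sqrt true (M01 l) (M'01 l).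
have := bern_sqrt false (M01 l) (M'01 l).
rewrite /= => <- <-; ring.
Qed.

(** Markov's inequality for [expR (llr M M' f / 2)]. Each factor of the resulting product is then
    bounded by [kl_le_hellinger] followed by 1 - x <= e^(-x). *)
Lemma chernoff_llr (R : realType) (N K : nat) (M M' : edge N K -> R)
    (gamma C s : R) :
  (forall l, 0 < M l < 1) -> (forall l, 0 < M' l < 1) ->
  2 <= C -> 0 <= gamma <= 1 ->
  (forall l, ln (M l / M' l) <= C) ->
  (forall l, ln ((1 - M l) / (1 - M' l)) <= C) ->
  \sum_(f : outcome N K | - s <= llr M M' f) outcome_weight M gamma f <=
    expR (s / 2 - gamma * (\sum_l KL_bernoulli (M l) (M' l)) / (4 * C)).
Proof.
move=> M01 M'01 C2 /andP[g0 g1] h1 h2.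
have w0 f : 0 <= outcome_weight M gamma f.
  apply: outcome_weight_ge0; last by rewrite g0.
  by move=> l; have /andP[m0 m1] := M01 l; rewrite !ltW.
apply: (@le_trans _ _ (expR (s / 2) *
    \sum_(f : outcome N K) outcome_weight M gamma f * expR (llr M M' f / 2))).
  rewrite mulr_sumr big_mkcond /=; apply: ler_sum => f _.
  case: ifPn => sf; last by rewrite !mulr_ge0// expR_ge0.
  rewrite mulrCA -expRD ler_peMr// -[leLHS]expR0 ler_expR; lra.
rewrite sum_outcome_chernoff// expRD ler_pM2l ?expR_gt0//.
rewrite mulr_sumr mulr_suml -sumrN expR_sum; apply: ler_prod => l _.
have kl := kl_le_hellinger C2 (M01 l) (M'01 l) (h1 l) (h2 l).
have a0 := addr_ge0 (sqrtr_ge0 (M l * M' l))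
                    (sqrtr_ge0 ((1 - M l) * (1 - M' l))).
move: (Num.sqrt _ + Num.sqrt _) a0 kl => a a0 kl.
apply/andP; split; first by nra.
apply: (le_trans _ (expR_ge1Dx _)); rewrite lerD2l lerN2 -mulrA ler_wpM2l//.
by rewrite ler_pdivrMr; lra.
Qed.

(** * Quantization of the parameter space *)

Lemma exists_quantizer (R : realType) (U : R) (k : nat) : (0 < k)%N ->
  exists g : R -> 'I_k.+1, forall a b, `|a| <= U -> `|b| <= U -> g a = g b ->
    `|a - b| <= 2 * U / k%:R.
Proof.
move=> k0; have kR : 0 < k%:R :> R by rewrite ltr0n.
pose y a : R := (a + U) / (2 * U) * k%:R.
(* [-U, U] is rescaled to [0, k] and truncated. The endpoint U gets index k, whence k + 1 values. *)
exists (fun a => inord (Num.truncn (y a))) => a b.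
rewrite !ler_norml => /andP[a1 a2] /andP[b1 b2] gab.
(* The rescaling divides by 2U, so the degenerate interval is treated apart. *)
have [U0|U0] := ltrP 0 U; last first.
  have -> : a = 0 by lra.
  have -> : b = 0 by lra.
  have -> : U = 0 by lra.
  by rewrite subrr !mulr0 mul0r lexx oppr0 lexx.
have yb c : - U <= c -> c <= U -> 0 <= y c /\ (Num.truncn (y c) < k.+1)%N.
  move=> c1 c2.
  have y0 : 0 <= y c.
    by rewrite /y mulr_ge0 ?ler0n// divr_ge0//; lra.
  split=> //; have /andP[t1 _] := truncn_itv y0.
  rewrite ltnS -(ler_nat R) (le_trans t1)// /y ler_piMl ?ler0n//.
  by rewrite ler_pdivrMr ?mul1r; lra.
have [ya0 yak] := yb a a1 a2; have [yb0 ybk] := yb b b1 b2.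
have /(congr1 val) := gab; rewrite /= !inordK// => E.
have /andP[ta1 ta2] := truncn_itv ya0; have /andP[tb1 tb2] := truncn_itv yb0.
rewrite E in ta1 ta2; rewrite -natr1 in ta2 tb2.
have aE : a = y a * (2 * U / k%:R) - U.
  by rewrite /y; field; rewrite !gt_eqF.
have bE : b = y b * (2 * U / k%:R) - U.
  by rewrite /y; field; rewrite !gt_eqF.
have w0 : 0 < 2 * U / k%:R by rewrite divr_gt0//; lra.
move: (2 * U / k%:R) w0 aE bE => w w0 -> ->.
by apply/andP; split; nra.
Qed.

Lemma enorm_coord (R : realType) (n : nat) (v : 'rV[R]_n) (i : 'I_n) :
  `|v 0 i| <= enorm v.
Proof.
rewrite /enorm -sqrtr_sqr ler_sqrt; last first.
  by apply: sumr_ge0 => j _; exact: sqr_ge0.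
by rewrite (bigD1 i)//= lerDl; apply: sumr_ge0 => j _; exact: sqr_ge0.
Qed.

(** The factor n instead of sqrt n is harmless: it only enters the constant in front of n/k. *)
Lemma enorm_le (R : realType) (n : nat) (v : 'rV[R]_n) (e : R) : 0 <= e ->
  (forall i, `|v 0 i| <= e) -> enorm v <= n%:R * e.
Proof.
move=> e0 ve; rewrite -[leRHS]ger0_norm ?mulr_ge0// -sqrtr_sqr /enorm.
rewrite ler_wsqrtr// exprMn.
apply: (@le_trans _ _ (\sum_(i < n) e ^+ 2)).
  by apply: ler_sum => i _; rewrite -real_normK ?num_real// lerXn2r// nnegrE.
rewrite sumr_const card_ord -[leLHS]mulr_natl ler_wpM2r ?sqr_ge0//.
rewrite -natrX ler_nat; case: n {v ve} => // n.
by rewrite expnS expn1 leq_pmulr.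
Qed.

Section cells.
Variables (R : realType) (dE dR N K k : nat) (cE : 'rV[R]_dE) (cR : 'rV[R]_dR).
Variable g : R -> 'I_k.+1.

Definition cell_type : finType :=
  {ffun ('I_N * 'I_dE) + ('I_K * 'I_dR) -> 'I_k.+1}.

Definition cell (x : param R dE dR N K) : cell_type :=
  [ffun i => match i with
             | inl (i, j) => g (x.1 i 0 j - cE 0 j)
             | inr (i, j) => g (x.2 i 0 j - cR 0 j)
             end].

Lemma card_cell_type : #|cell_type| = (k.+1 ^ (N * dE + K * dR))%N.
Proof. by rewrite card_ffun card_sum !card_prod !card_ord. Qed.

Lemma cell_close (U e : R) (x y : param R dE dR N K) :
  0 <= e ->
  (forall a b, `|a| <= U -> `|b| <= U -> g a = g b -> `|a - b| <= e) ->
  Theta (eball cE U) (eball cR U) N K x ->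
  Theta (eball cE U) (eball cR U) N K y ->
  cell x = cell y ->
  forall l, enorm (at_edge x l - at_edge y l) <= (dE + dE + dR)%:R * e.
Proof.
move=> e0 ge [x1 x2] [y1 y2] /ffunP xy [[i j] r].
have cl n (c u v : 'rV[R]_n) s : eball c U u -> eball c U v ->
    g (u 0 s - c 0 s) = g (v 0 s - c 0 s) -> `|u 0 s - v 0 s| <= e.
  rewrite /eball /= => uU vU E.
  have uU' : `|u 0 s - c 0 s| <= U.
    by apply: le_trans uU; have := enorm_coord (u - c) s; rewrite !mxE.
  have vU' : `|v 0 s - c 0 s| <= U.
    by apply: le_trans vU; have := enorm_coord (v - c) s; rewrite !mxE.
  by have := ge _ _ uU' vU' E; rewrite opprB addrA subrK.
apply: enorm_le => // s; rewrite /at_edge /= opp_row_mx add_row_mx.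
rewrite opp_row_mx add_row_mx !mxE; case: splitP => [s1 _|s1 _]; last first.
  by rewrite !mxE (cl _ cR)//; have := xy (inr (r, s1)); rewrite !ffunE.
rewrite !mxE; case: splitP => s2 _; rewrite !mxE (cl _ cE)//.
  by have := xy (inl (i, s2)); rewrite !ffunE.
by have := xy (inl (j, s2)); rewrite !ffunE.
Qed.
End cells.

(** * Log-likelihood as a sum over edges *)

Lemma at_edge_domain (R : realType) (dE dR N K : nat) (E : set 'rV[R]_dE)
    (Rel : set 'rV[R]_dR) (x : param R dE dR N K) (l : edge N K) :
  Theta E Rel N K x -> score_domain E Rel (at_edge x l).
Proof.
by move=> [x1 x2]; rewrite /score_domain /at_edge /= !row_mxKl !row_mxKr.
Qed.

Lemma loglikE (R : realType) (dE dR N K : nat)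
    (phi : 'rV[R]_(dE + dE + dR) -> R) (T : Type) (Y O : edge N K -> T -> bool)
    (w : T) (x : param R dE dR N K) :
  loglik phi (fun l => Y l w) (observed O w) x =
  \sum_l (if O l w then ln (bern (Mprob phi x l) (Y l w)) else 0).
Proof.
rewrite /loglik big_mkcond /=; apply: eq_bigr => l _; rewrite inE.
case: (O l w) => //; rewrite /bern.
by case: (Y l w); rewrite ?subrr ?mul1r ?mul0r ?subr0 ?mul1r ?addr0 ?add0r.
Qed.

Lemma llr_loglik (R : realType) (dE dR N K : nat)
    (phi : 'rV[R]_(dE + dE + dR) -> R) (T : Type) (Y O : edge N K -> T -> bool)
    (w : T) (x x' : param R dE dR N K) :
  llr (Mprob phi x) (Mprob phi x') [ffun l => (Y l w, O l w)] =
  loglik phi (fun l => Y l w) (observed O w) x' -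
  loglik phi (fun l => Y l w) (observed O w) x.
Proof.
rewrite !loglikE -sumrB /llr; apply: eq_bigr => l _; rewrite ffunE /=.
by case: (O l w); rewrite ?subrr.
Qed.

(** For either label the summand is the log of a sigmoid at plus or minus the score, hence
    1-Lipschitz in the score. The bound counts all edges, observed or not, and is thus uniform in
    the data. *)
Lemma loglik_lip (R : realType) (dE dR N K : nat)
    (phi : 'rV[R]_(dE + dE + dR) -> R) (T : Type) (Y O : edge N K -> T -> bool)
    (w : T) (x x' : param R dE dR N K) (e : R) :
  0 <= e ->
  (forall l, `|phi (at_edge x l) - phi (at_edge x' l)| <= e) ->
  loglik phi (fun l => Y l w) (observed O w) x <=
  loglik phi (fun l => Y l w) (observed O w) x' + #|edge N K|%:R * e.
Proof.
move=> e0 xe; rewrite -lerBlDl !loglikE -sumrB.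
apply: (@le_trans _ _ (\sum_(l : edge N K) e)); last first.
  by rewrite sumr_const mulr_natl.
apply: ler_sum => l _; case: (O l w); last by rewrite subrr.
apply: (le_trans _ (xe l)); rewrite /bern /Mprob; case: (Y l w).
  exact: ln_sigmoid_lip.
rewrite !sigmoidN (le_trans (ln_sigmoid_lip _ _))//.
by rewrite -opprD normrN.
Qed.

(** * Tail and expectation bounds at a fixed N *)

Section fixed_size.
Variables (R : realType) (C U alpha gamma : R) (N K dE dR : nat).
Hypotheses (N0 : (0 < N)%N) (K0 : (0 < K)%N).
Hypotheses (gamma01 : 0 < gamma <= 1) (C2 : 2 <= C).
Variables (cE : 'rV[R]_dE) (cR : 'rV[R]_dR) (phi : 'rV[R]_(dE + dE + dR) -> R).
Let dom := score_domain (eball cE U) (eball cR U).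
Let Th := Theta (eball cE U) (eball cR U) N K.
Hypothesis phiC : forall u, dom u -> `|phi u| <= C.
Hypothesis phi_lip :
  forall u v, dom u -> dom v -> `|phi u - phi v| <= alpha * enorm (u - v).
Variable xs : param R dE dR N K.
Hypothesis Th_xs : Th xs.

Lemma Mprob01 (x : param R dE dR N K) l : 0 < Mprob phi x l < 1.
Proof. exact: sigmoid_gt0_lt1. Qed.

Lemma Mprob_ratio_le (x y : param R dE dR N K) l : Th x -> Th y ->
  ln (Mprob phi x l / Mprob phi y l) <= C /\
  ln ((1 - Mprob phi x l) / (1 - Mprob phi y l)) <= C.
Proof.
move=> hx hy; have px := phiC (at_edge_domain l hx).
have py := phiC (at_edge_domain l hy).
split; first exact: ln_sigmoid_ratio_le.
by rewrite /Mprob !sigmoidN ln_sigmoid_ratio_le// normrN.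
Qed.

Lemma card_edge_gt0 : 0 < #|edge N K|%:R :> R.
Proof. by rewrite ltr0n !card_prod !card_ord !muln_gt0 N0 K0. Qed.

Lemma avg_loss_bounds (x : param R dE dR N K) : Th x ->
  0 <= avg_loss (Mprob phi x) (Mprob phi xs) <= C.
Proof.
move=> hx; rewrite /avg_loss divr_ge0 ?ler0n//=; last first.
  by apply: sumr_ge0 => l _; apply: kl_ge0; exact: Mprob01.
rewrite ler_pdivrMr ?card_edge_gt0//.
apply: (@le_trans _ _ (\sum_(l : edge N K) C)).
  apply: ler_sum => l _; have [h1 h2] := Mprob_ratio_le l Th_xs hx.
  by apply: kl_le => //; exact: Mprob01.
by rewrite sumr_const mulr_natr.
Qed.

Variables (d : measure_display) (T : measurableType d) (P : probability T R).
Variables (Y O : edge N K -> {RV P >-> bool}).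
Hypothesis YO : network_model Y O (Mprob phi xs) gamma.
Variable xhat : T -> param R dE dR N K.
Hypothesis xhatP :
  forall w, is_mle phi Th (fun l => Y l w) (observed O w) (xhat w).
Hypothesis xhat_meas :
  forall l, measurable_fun setT (fun w => Mprob phi (xhat w) l).

Let loss w := avg_loss (Mprob phi (xhat w)) (Mprob phi xs).

Lemma measurable_loss : measurable_fun setT loss.
Proof.
(* All probabilities lie strictly between 0 and 1, so logarithms of quotients split, and only
   measurable operations on the entries of M(xhat) remain. *)
have -> : loss = (fun w => (\sum_l
    (Mprob phi xs l * (ln (Mprob phi xs l) - ln (Mprob phi (xhat w) l)) +
     (1 - Mprob phi xs l) *
       (ln (1 - Mprob phi xs l) - ln (1 - Mprob phi (xhat w) l))))
    * #|edge N K|%:R^-1).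
  apply/funext => w; rewrite /loss /avg_loss; congr (_ / _).
  apply: eq_bigr => l _; rewrite /KL_bernoulli.
  have /andP[p0 p1] := Mprob01 xs l; have /andP[q0 q1] := Mprob01 (xhat w) l.
  have p1' : 0 < 1 - Mprob phi xs l by rewrite subr_gt0.
  have q1' : 0 < 1 - Mprob phi (xhat w) l by rewrite subr_gt0.
  move: (Mprob phi xs l) (Mprob phi (xhat w) l) p0 q0 p1' q1' {p1 q1} => p q.
  by move=> *; rewrite !ln_div.
have mln (f : T -> R) : measurable_fun setT f ->
    measurable_fun setT (fun w => ln (f w)).
  by move=> mf; exact: (measurableT_comp (@measurable_ln R) mf).
have mB (f : T -> R) (c : R) : measurable_fun setT f ->
    measurable_fun setT (fun w => c - f w).
  by move=> mf; apply: measurable_funB => //; exact: measurable_cst.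
apply: measurable_funM; last exact: measurable_cst.
apply: measurable_sum => l; apply: measurable_funD.
  by apply: measurable_funM; [exact: measurable_cst|exact/mB/mln].
by apply: measurable_funM; [exact: measurable_cst|exact/mB/mln/mB].
Qed.

Lemma measurable_loss_ge t : measurable [set w | t <= loss w].
Proof.
rewrite -[X in measurable X]setTI.
have -> : [set w | t <= loss w] = loss @^-1` `[t, +oo[%classic.
  by apply/seteqP; split=> w /=; rewrite in_itv/= andbT.
exact: measurable_loss.
Qed.

Lemma loss_tail_bound (k : nat) (t : R) : (0 < k)%N ->
  (P [set w | (t <= loss w)%R] <=
    (k.+1%:R ^+ (N * dE + K * dR) *
     expR (nobs gamma N K * (`|alpha| * (dE + dE + dR)%:R * U / gamma / k%:R)
           - nobs gamma N K * t / (4 * C)))%:E)%E.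
Proof.
have C40 : 0 < 4 * C by move: C2; lra.
move=> k0; have [g gP] := exists_quantizer U k0.
have /andP[g0 g1] := gamma01.
have U0 : 0 <= U.
  have [_ /(_ (Ordinal K0))] := Th_xs.
  by rewrite /eball /=; apply: le_trans; exact: sqrtr_ge0.
have e0 : 0 <= 2 * U / k%:R by rewrite divr_ge0 ?ler0n// mulr_ge0.
pose e := `|alpha| * ((dE + dE + dR)%:R * (2 * U / k%:R)).
have e_ge0 : 0 <= e by rewrite !mulr_ge0.
pose cl := @cell R dE dR N K k cE cR g.
pose W c := [set x | [/\ Th x, cl x = c &
                       t <= avg_loss (Mprob phi x) (Mprob phi xs)]].
(* The representative has loss at least t itself, so no loss is given up in passing to it from the
   estimator. The default [xs] occurs only for an empty [W c], where [G c] rejects every outcome. *)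
pose rep c := xget xs (W c).
pose s := #|edge N K|%:R * e.
pose G c (f : outcome N K) :=
  `[< W c !=set0 >] && (- s <= llr (Mprob phi xs) (Mprob phi (rep c)) f).
have repP c : W c !=set0 -> W c (rep c).
  by case=> x Wx; apply: xgetPex; exists x.
have mle_G w : [set w | t <= loss w] w ->
    [exists c, G c [ffun l => (Y l w, O l w)]].
  move=> /= tw; have [hTh hmax] := xhatP w.
  have Wx : W (cl (xhat w)) (xhat w) by [].
  have Wne : W (cl (xhat w)) !=set0 by exists (xhat w).
  have [rTh rcl _] := repP _ Wne.
  apply/existsP; exists (cl (xhat w)); rewrite /G asboolT//=.
  rewrite (llr_loglik phi (fun l => Y l) (fun l => O l) w xs).
  have close l : `|phi (at_edge (xhat w) l) -
                   phi (at_edge (rep (cl (xhat w))) l)| <= e.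
    apply: (le_trans (phi_lip (at_edge_domain l hTh) (at_edge_domain l rTh))).
    apply: (@le_trans _ _ (`|alpha| *
        enorm (at_edge (xhat w) l - at_edge (rep (cl (xhat w))) l))).
      by rewrite ler_wpM2r ?sqrtr_ge0// ler_norm.
    by rewrite ler_wpM2l// (cell_close e0 gP hTh rTh).
  have := loglik_lip (fun l => Y l) (fun l => O l) w e_ge0 close.
  (* The chain is: log-likelihood at [xs] <= at [xhat w] <= at the representative plus s. *)
  by have := hmax _ Th_xs; rewrite -/s; lra.
have M01 l : 0 <= Mprob phi xs l <= 1.
  by have /andP[a b] := Mprob01 xs l; rewrite !ltW.
have gamma01' : 0 <= gamma <= 1 by rewrite ltW.
apply: (le_trans (prob_le_outcome_weight (G := fun f => [exists c, G c f])
                   M01 gamma01' YO (measurable_loss_ge t) mle_G)).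
rewrite lee_fin.
have w0 f : 0 <= outcome_weight (Mprob phi xs) gamma f :> R.
  exact: outcome_weight_ge0.
apply: (@le_trans _ _ (\sum_c \sum_(f | G c f)
    outcome_weight (Mprob phi xs) gamma f)).
  (* Union bound: an outcome accepted by some cell is counted at least once on the right. *)
  rewrite big_mkcond (exchange_big_dep xpredT) //=; apply: ler_sum => f _.
  case: ifPn => [exG|_]; last exact: sumr_ge0.
  have [c Gc] : exists c, G c f by apply/existsP.
  rewrite [leRHS](bigD1 c) ?Gc//= lerDl; exact: sumr_ge0.
rewrite -natrX -(card_cell_type dE dR N K k) mulr_natl -sumr_const.
apply: ler_sum => c _.
rewrite /G; case: asboolP => [/repP[rTh _ rt]|_]; last first.
  by rewrite big_pred0// expR_ge0.
apply: (le_trans (chernoff_llr s (Mprob01 xs) (Mprob01 (rep c)) C2 gamma01'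
  (fun l => (Mprob_ratio_le l Th_xs rTh).1)
  (fun l => (Mprob_ratio_le l Th_xs rTh).2))).
rewrite ler_expR.
have nE : nobs gamma N K = gamma * #|edge N K|%:R.
  by rewrite /nobs !card_prod !card_ord !natrM; ring.
move: rt; rewrite /avg_loss ler_pdivlMr ?card_edge_gt0// => rt.
rewrite lerB//.
  (* An equality: the Chernoff exponent 1/2 cancels the 2 of the cell width 2U/k, and 1/gamma turns
     n into the number of edges. *)
  rewrite nE /s /e le_eqVlt; apply/orP; left; apply/eqP.
  by field; rewrite !gt_eqF// ltr0n.
rewrite ler_pM2r ?invr_gt0//.
by rewrite nE -mulrA ler_pM2l// mulrC.
Qed.

(** The loss is below t off the event and at most C on it, so it is dominated by t plus C times the
    indicator. *)
Lemma expectation_loss_le (t : R) : 0 <= t ->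
  ('E_P[loss] <= t%:E + C%:E * P [set w | (t <= loss w)%R])%E.
Proof.
move=> t0; pose A := [set w | (t <= loss w)%R].
have mA : measurable A := measurable_loss_ge t.
have C0 : 0 <= C by move: C2; lra.
have mA0 : measurable_fun setT (\1_A : T -> R) by exact: measurable_indic.
have mA1 : measurable_fun setT (fun w => (C * \1_A w)%:E : \bar R).
  by apply/measurable_EFinP; apply: measurable_funM.
pose B w : R := t + C * \1_A w.
apply: (@le_trans _ _ ('E_P[B])%E).
  apply: expectation_le.
  - exact: measurable_loss.
  - by apply: measurable_funD => //; apply/measurable_EFinP.
  - by move=> w; have [/avg_loss_bounds/andP[]] := xhatP w.
  - by move=> w; rewrite addr_ge0// mulr_ge0.
  - apply: aeW => w; have [/avg_loss_bounds/andP[l0 lC] _] := xhatP w.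
    rewrite /B indicE; case: (boolP (w \in A)) => [_|].
      by rewrite mulr1 (le_trans lC)// lerDr.
    by rewrite notin_setE /A /= => /negP; rewrite -ltNge mulr0 addr0 => /ltW.
rewrite unlock; under eq_integral do rewrite /B EFinD.
rewrite ge0_integralD//=; last by move=> w _; rewrite lee_fin mulr_ge0.
have -> : (\int[P]__ t%:E = t%:E)%E.
  by rewrite integral_cst// [X in (_ * X)%E](probability_setT P) mule1.
rewrite leeD2l//.
under eq_integral do rewrite EFinM.
rewrite ge0_integralZl_EFin//=; first by rewrite integral_indic// setIT.
by apply/measurable_EFinP.
Qed.
End fixed_size.

(** * Asymptotics in N *)

Lemma limn_einf_ge (R : realType) (u : nat -> \bar R) (l : \bar R) :
  (\forall n \near \oo, (l <= u n)%E) -> (l <= limn_einf u)%E.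
Proof.
move=> [m _ ul]; rewrite limn_einf_lim; apply: lime_ge.
  exact: is_cvg_einfs.
exists m => // n /= mn; apply: le_ereal_inf_tmp => _ [i /= ni <-].
by apply: ul; rewrite /= (leq_trans mn).
Qed.

Lemma limn_esup_le (R : realType) (u : nat -> \bar R) (l : \bar R) :
  (\forall n \near \oo, (u n <= l)%E) -> (limn_esup u <= l)%E.
Proof.
move=> [m _ ul]; rewrite limn_esup_lim; apply: lime_le.
  exact: is_cvg_esups.
exists m => // n /= mn; apply: ge_ereal_sup => _ [i /= ni <-].
by apply: ul; rewrite /= (leq_trans mn).
Qed.

Lemma lesssim_neg_lne (R : realType) (p : nat -> \bar R) (b : nat -> R) :
  (\forall N \near \oo, 0 < b N /\ (0 <= p N <= (expR (- b N))%:E)%E) ->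
  lesssim_neg (fun N => lne (p N)) (fun N => (- b N)%:E).
Proof.
move=> h; apply: limn_einf_ge; apply: filterS h => N [b0 /andP[p0 pb]].
have nb0 : - b N < 0 by rewrite oppr_lt0.
rewrite inver lt_eqF//.
case: (p N) p0 pb => [r| |] //=; rewrite !lee_fin => r0 rb.
(* A vanishing probability has logarithm -oo, and its quotient by a negative number is +oo. *)
case: ifPn => [_|]; first by rewrite lt0_mulNye ?leey// lte_fin invr_lt0.
rewrite -ltNge => r0'.
rewrite -EFinM lee_fin ler_ndivlMr// mul1r -[leRHS]expRK ler_ln//.
by rewrite posrE expR_gt0.
Qed.

Lemma nobs_div_pdim_near (R : realType) (gamma a : R) (K dE dR : nat) :
  (0 < K)%N -> (0 < dE + dR)%N -> 0 < gamma ->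
  \forall N \near \oo, [/\ (0 < N)%N, 1 <= pdim R dE dR N K &
    a <= nobs gamma N K / pdim R dE dR N K].
Proof.
move=> K0 d0 g0.
pose D : R := (dE + K * dR)%:R.
have K0' : 0 < K%:R :> R by rewrite ltr0n.
near=> N.
have N0 : (0 < N)%N by near: N; exact: nbhs_infty_gt.
have m1 : (1 <= N * dE + K * dR)%N.
  rewrite lt0n addn_eq0 !muln_eq0 !negb_and !negb_or -!lt0n N0 K0 /=.
  by move: d0; rewrite !lt0n addn_eq0 negb_and.
have m1R : 1 <= pdim R dE dR N K by rewrite /pdim ler1n.
have mD : pdim R dE dR N K <= N%:R * D.
  rewrite /pdim /D -natrM ler_nat mulnDr leq_add2l.
  by rewrite leq_pmull.
have NA : `|a| * D / (gamma * K%:R) <= N%:R.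
  by near: N; exact: nbhs_infty_ger.
split=> //; rewrite ler_pdivlMr; last lra.
move: NA; rewrite ler_pdivrMr ?mulr_gt0// => NA.
apply: (@le_trans _ _ (`|a| * (N%:R * D))).
  apply: (@le_trans _ _ (`|a| * pdim R dE dR N K)).
    by rewrite ler_wpM2r ?ler_norm//; lra.
  by rewrite ler_wpM2l.
rewrite /nobs.
have -> : gamma * N%:R ^+ 2 * K%:R = N%:R * (N%:R * (gamma * K%:R)) by ring.
have -> : `|a| * (N%:R * D) = N%:R * (`|a| * D) by ring.
by rewrite ler_wpM2l.
Unshelve. all: by end_near. Qed.

Theorem theorem1 (R : realType) (C U alpha gamma : R) (K dE dR : nat)
    (hK : (0 < K)%N) (hdim : (0 < dE + dR)%N)
    (hgamma : 0 < gamma <= 1) (hC2 : 2 <= C)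
    (cE : nat -> 'rV[R]_dE) (cR : nat -> 'rV[R]_dR)
    (phi : nat -> 'rV[R]_(dE + dE + dR) -> R)
    (hC : forall N : nat,
       C = sup [set `|phi N u| |
                 u in score_domain (eball (cE N) U) (eball (cR N) U)])
    (hphi : forall (N : nat) (u v : 'rV[R]_(dE + dE + dR)),
       score_domain (eball (cE N) U) (eball (cR N) U) u ->
       score_domain (eball (cE N) U) (eball (cR N) U) v ->
       `|phi N u - phi N v| <= alpha * enorm (u - v))
    (xstar : forall N : nat, param R dE dR N K)
    (hxstar : forall N : nat,
       Theta (eball (cE N) U) (eball (cR N) U) N K (xstar N))
    (d : nat -> measure_display) (T : forall N : nat, measurableType (d N))
    (P : forall N : nat, probability (T N) R)
    (Y O : forall N : nat, edge N K -> {RV (P N) >-> bool})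
    (hmodel : forall N : nat,
       network_model (Y N) (O N) (Mprob (phi N) (xstar N)) gamma)
    (xhat : forall N : nat, T N -> param R dE dR N K)
    (hxhat : forall (N : nat) (w : T N),
       is_mle (phi N) (Theta (eball (cE N) U) (eball (cR N) U) N K)
         (fun l => Y N l w) (observed (O N) w) (xhat N w))
    (hmeas : forall (N : nat) (l : edge N K),
       measurable_fun setT (fun w : T N => Mprob (phi N) (xhat N w) l)) :
  let loss (N : nat) (w : T N) : R :=
    avg_loss (Mprob (phi N) (xhat N w)) (Mprob (phi N) (xstar N)) in
  let n (N : nat) : R := nobs gamma N K in
  let m (N : nat) : R := pdim R dE dR N K in
  let t2 (N : nat) : R := 10 * C * (m N / n N) * ln (n N / m N) in
  [/\ forall t : R, 0 < t ->
        lesssim_neg (fun N => lne (P N [set w | t <= loss N w]))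
                    (fun N => (- (t / (5 * C) * n N))%:E),
      lesssim_neg (fun N => lne (P N [set w | t2 N <= loss N w]))
                  (fun N => (- (m N * ln (n N / m N)))%:E)
    & lesssim_pos (fun N => ('E_(P N)[loss N])%E) (fun N => (t2 N)%:E)].
Proof.
move=> loss n m t2.
have /andP[g0 g1] := hgamma.
have phiC N u : score_domain (eball (cE N) U) (eball (cR N) U) u ->
    `|phi N u| <= C.
  move=> du; rewrite [leRHS](hC N); apply: ub_le_sup; last by exists u.
  (* The supremum of an unbounded set is 0 by convention, which C >= 2 excludes. *)
  apply: contrapT => nub.
  have : sup [set `|phi N u| | u in
      score_domain (eball (cE N) U) (eball (cR N) U)] = 0.
    by apply: sup_out => -[].
  by rewrite -hC; lra.
have U0 : 0 <= U.
  have [_ /(_ (Ordinal hK))] := hxstar 0%N.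
  by rewrite /eball /=; apply: le_trans; exact: sqrtr_ge0.
pose B : R := `|alpha| * (dE + dE + dR)%:R * U / gamma.
have B0 : 0 <= B by rewrite /B !mulr_ge0// invr_ge0 ltW.
have tail N k (a t : R) : (0 < N)%N -> (0 < k)%N -> k.+1%:R <= a ->
    (P N [set w | (t <= loss N w)%R] <=
     (expR (m N * ln a + n N * (B / k%:R) - n N * t / (4 * C)))%:E)%E.
  move=> N0 k0 ka.
  apply: (le_trans (loss_tail_bound N0 hK hgamma hC2 (phiC N) (@hphi N)
    (hxstar N) (hmodel N) (@hxhat N) (@hmeas N) t k0)).
  rewrite lee_fin -addrA [leRHS]expRD ler_pM2r ?expR_gt0//.
  have a0 : 0 < a by apply: lt_le_trans ka; rewrite ltr0n.
  rewrite /m /pdim mulr_natl -lnXn// lnK ?posrE ?exprn_gt0//.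
  by rewrite lerXn2r// nnegrE ltW.
have ii : \forall N \near \oo, 0 < m N * ln (n N / m N) /\
    (0 <= P N [set w | (t2 N <= loss N w)%R] <=
      (expR (- (m N * ln (n N / m N))))%:E)%E.
  (* Beyond this threshold ln 3 + B is at most half of ln (n/m). *)
  pose a := expR (1 + 2 * (ln 3 + B)).
  apply: filterS (nobs_div_pdim_near a hK hdim g0) => N [N0 m1].
  rewrite -/(n N) -/(m N) => an.
  have m0 : 0 < m N by rewrite (lt_le_trans _ m1).
  have rho0 : 0 < n N / m N by apply: lt_le_trans an; exact: expR_gt0.
  have ln30 : 0 <= ln 3 :> R by rewrite ln_ge0// ler1n.
  have rho1 : 1 <= n N / m N.
    by apply: le_trans an; rewrite -expR0 ler_expR; lra.
  have lnrho : 1 + 2 * (ln 3 + B) <= ln (n N / m N).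
    by rewrite -[leLHS]expRK ler_ln// posrE expR_gt0.
  have n0 : 0 < n N by move: rho0; rewrite pmulr_lgt0 ?invr_gt0.
  split; first by rewrite mulr_gt0//; lra.
  rewrite measure_ge0 /=.
  (* This k exceeds n/m, so the grid term n B / k is at most m B; and k + 1 <= n/m + 2 <= 3 n/m. *)
  pose k := (Num.truncn (n N / m N)).+1.
  have /andP[k1 k2] := truncn_itv (ltW rho0).
  have ka : k.+1%:R <= 3 * (n N / m N).
    by rewrite /k -natr1 -[X in X + 1]natr1; lra.
  apply: (le_trans (tail N k _ _ N0 isT ka)); rewrite lee_fin ler_expR.
  rewrite lnM ?posrE//.
  have h1 : n N * (B / k%:R) <= m N * B.
    rewrite mulrA ler_pdivrMr ?ltr0n//.
    have -> : n N = n N / m N * m N by rewrite divfK// gt_eqF.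
    have : 0 <= m N * B by rewrite mulr_ge0// ltW.
    by move: (ltW k2); rewrite -/k; nra.
  (* Of the 5/2 units of m ln (n/m), one pays for the number of cells, one is the target, and the
     last half absorbs m (ln 3 + B). *)
  have h2 : n N * t2 N / (4 * C) = 5 / 2 * (m N * ln (n N / m N)).
    rewrite /t2; move: (ln _) => z; field.
    by rewrite !gt_eqF//; lra.
  by rewrite h2; move: (ln (n N / m N)) lnrho => z lnrho; nra.
split.
- move=> t t0; apply: lesssim_neg_lne.
  (* In units of n t / (40 C), the Chernoff term is 10 and the target 8. This k makes the grid term
     at most 1, and n/m >= a makes m ln (k + 1) at most 1. *)
  pose k := (Num.truncn (40 * C * B / t)).+1.
  pose a := 1 + 40 * C / t * ln k.+1%:R.
  apply: filterS (nobs_div_pdim_near a hK hdim g0) => N [N0 m1].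
  rewrite -/(n N) -/(m N) => an.
  have m0 : 0 < m N by rewrite (lt_le_trans _ m1).
  have k0 : 0 < k%:R :> R by rewrite ltr0n.
  have lnk : 0 <= ln k.+1%:R :> R by rewrite ln_ge0// ler1n.
  have C0 : 0 < C by lra.
  have a1 : 1 <= a by rewrite /a lerDl !mulr_ge0// ?invr_ge0 ltW.
  have n0 : 0 < n N.
    have : 0 < n N / m N by lra.
    by rewrite pmulr_lgt0 ?invr_gt0.
  split; first by rewrite mulr_gt0// divr_gt0// mulr_gt0.
  rewrite measure_ge0 /=.
  apply: (le_trans (tail N k _ t N0 isT (lexx _))); rewrite lee_fin ler_expR.
  have h1 : B / k%:R <= t / (40 * C).
    rewrite ler_pdivrMr//.
    have := ltW (real_truncnS_gt (num_real (40 * C * B / t))).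
    rewrite -/k ler_pdivrMr// => h.
    by rewrite mulrAC ler_pdivlMr ?mulr_gt0//; lra.
  have h2 : m N * ln k.+1%:R <= n N * (t / (40 * C)).
    move: an; rewrite ler_pdivlMr// => an.
    have : 40 * C / t * ln k.+1%:R * m N <= n N by rewrite /a in an; lra.
    rewrite -(ler_pM2r (_ : 0 < t / (40 * C))) ?divr_gt0 ?mulr_gt0//.
    congr (_ <= _); field; rewrite !gt_eqF//.
  have h3 := ler_wpM2l (ltW n0) h1.
  have -> : n N * t / (4 * C) = 10 * (n N * (t / (40 * C))).
    by field; rewrite gt_eqF.
  have -> : t / (5 * C) * n N = 8 * (n N * (t / (40 * C))).
    by field; rewrite gt_eqF.
  by lra.
- exact: lesssim_neg_lne.
- rewrite /lesssim_pos; apply/lee_addgt0Pr => e e0.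
  apply: limn_esup_le.
  (* Then e ln (n/m) >= 1, so the remainder C m/n is at most e times [t2 N]. *)
  pose a := expR (1 + e^-1).
  apply: filterS2 ii (nobs_div_pdim_near a hK hdim g0) => N [b0 /andP[_ Pt]].
  move=> [N0 m1]; rewrite -/(n N) -/(m N) => an.
  have m0 : 0 < m N by rewrite (lt_le_trans _ m1).
  have C0 : 0 < C by lra.
  have ei0 : 0 < e^-1 by rewrite invr_gt0.
  have rho0 : 0 < n N / m N by apply: lt_le_trans an; exact: expR_gt0.
  have lnrho : 1 + e^-1 <= ln (n N / m N).
    by rewrite -[leLHS]expRK ler_ln// posrE expR_gt0.
  have n0 : 0 < n N by move: rho0; rewrite pmulr_lgt0 ?invr_gt0.
  have mn0 : 0 < m N / n N by rewrite divr_gt0.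
  have l0 : 0 < ln (n N / m N) by lra.
  have t20 : 0 < t2 N by rewrite /t2 !mulr_gt0 ?invr_gt0.
  rewrite inver gt_eqF//.
  have := expectation_loss_le N0 hK hC2 (phiC N) (hxstar N) (@hxhat N)
    (@hmeas N) (ltW t20).
  (* As m >= 1, the bound exp (- m ln (n/m)) from (ii) is at most exp (- ln (n/m)) = m/n. *)
  have Ple : (P N [set w | (t2 N <= loss N w)%R] <= (m N / n N)%:E)%E.
    apply: (le_trans Pt); rewrite lee_fin.
    have lnmn : ln (m N / n N) = - ln (n N / m N).
      by rewrite -lnV ?posrE// invf_div.
    by rewrite -[leRHS](@lnK R) ?posrE// ler_expR lnmn lerN2 ler_peMl// ltW.
  move=> hE.
  have hE2 : ('E_(P N)[loss N] <= (t2 N + C * (m N / n N))%:E)%E.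
    by rewrite (le_trans hE)// EFinD leeD2l// EFinM lee_wpmul2l// lee_fin ltW.
  rewrite -EFinD lee_pdivrMr// -EFinM (le_trans hE2)// lee_fin.
  rewrite mulrDl mul1r lerD2l /t2.
  have -> : e * (10 * C * (m N / n N) * ln (n N / m N)) =
    C * (m N / n N) * (10 * (e * ln (n N / m N))) by ring.
  rewrite ler_peMr ?mulr_ge0 ?invr_ge0 ?(ltW C0) ?(ltW m0) ?(ltW n0)//.
  have : e * e^-1 = 1 by rewrite divff// gt_eqF.
  have := ler_wpM2l (ltW e0) lnrho; rewrite mulrDr mulr1; lra.
Qed.
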